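(* Let $\{a_n\}_{n=1}^\infty$ be a sequence of positive real numbers such that only finitely many of the $a_n$ are greater than $1$. For each $m\in\mathbb{N}$, $m \ge 1$, define $\Phi_m:\mathbb{R}\to\mathbb{R}$ by $\Phi_m = \phi_{a_m}\circ\phi_{a_{m-1}}\circ\cdots\circ\phi_{a_1}$. Then for every $x\in\mathbb{R}$, $$\lim_{m\to\infty}\Phi_m(x)=0.$$
   Context: For $a>0$, the function $\phi_a:\mathbb{R}\to\mathbb{R}$ is defined by $\phi_a(x)=\tanh(ax)$. *)

(* Defs.v *)
From Stdlib Require Export Reals Finite_sets.
Open Scope R_scope.

Definition phi (a x : R) : R := tanh (a * x).

(* Sequences are indexed from 1: the value [a 0%nat] is never used, and
   [Phi a 0] is the empty composition, so that [Phi a 1] is [phi (a 1%nat)]. *)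
Fixpoint Phi (a : nat -> R) (m : nat) : R -> R :=
  match m with
  | O => id
  | S k => comp (phi (a (S k))) (Phi a k)
  end.

(* Main.v *)
(** From some index on, the absolute values [u m = |Phi_m x|] satisfy
    [u (m+1) <= tanh (u m) <= u m], so they decrease to a limit [l >= 0].
    Continuity gives [l <= tanh l], and [tanh t < t] for [t > 0] forces
    [l = 0]. *)
Require Import Defs.
From Stdlib Require Import Reals Finite_sets Integers Lra Lia.
Open Scope R_scope.

Lemma cosh_pos (x : R) : 0 < cosh x.
Proof.
  unfold cosh.
  pose proof (exp_pos x); pose proof (exp_pos (- x)); lra.
Qed.

Lemma cosh_sqr_minus_sinh_sqr (x : R) : cosh x * cosh x - sinh x * sinh x = 1.
Proof.
  assert (H : exp x * exp (- x) = 1)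
    by (rewrite <- exp_plus, Rplus_opp_r; apply exp_0).
  (* Writing [1] as [exp x * exp (- x)] turns the goal into a polynomial identity in the two
     exponentials. *)
  unfold cosh, sinh; rewrite <- H; field.
Qed.

Lemma derivable_pt_lim_tanh (x : R) :
  derivable_pt_lim tanh x (/ (cosh x * cosh x)).
Proof.
  pose proof (cosh_pos x) as Hc.
  (* The new form is what the quotient rule yields for [sinh / cosh]. *)
  replace (/ (cosh x * cosh x))
    with ((cosh x * cosh x - sinh x * sinh x) / Rsqr (cosh x)).
  - apply (derivable_pt_lim_div sinh cosh);
      [apply derivable_pt_lim_sinh | apply derivable_pt_lim_cosh | lra].
  - rewrite cosh_sqr_minus_sinh_sqr; unfold Rsqr; field; lra.
Qed.

Lemma continuity_pt_tanh (x : R) : continuity_pt tanh x.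
Proof.
  apply derivable_continuous_pt.
  exists (/ (cosh x * cosh x)); apply derivable_pt_lim_tanh.
Qed.

Lemma tanh_0 : tanh 0 = 0.
Proof. unfold tanh; rewrite sinh_0; apply Rmult_0_l. Qed.

Lemma tanh_opp (x : R) : tanh (- x) = - tanh x.
Proof.
  pose proof (cosh_pos x) as Hc; unfold cosh in Hc.
  unfold tanh, sinh, cosh; rewrite Ropp_involutive; field; lra.
Qed.

Lemma tanh_lt (x y : R) : x < y -> tanh x < tanh y.
Proof.
  intros Hxy.
  destruct (MVT_cor2 tanh (fun c => / (cosh c * cosh c)) x y Hxy) as [c [Hc _]].
  { intros c _; apply derivable_pt_lim_tanh. }
  assert (0 < / (cosh c * cosh c) * (y - x)).
  { apply Rmult_lt_0_compat; [|lra].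
    apply Rinv_0_lt_compat, Rmult_lt_0_compat; apply cosh_pos. }
  lra.
Qed.

Lemma tanh_le (x y : R) : x <= y -> tanh x <= tanh y.
Proof.
  intros [Hxy | ->]; [left; now apply tanh_lt | right; reflexivity].
Qed.

(** By the mean value theorem, [tanh t = t / cosh(c)^2] for some [0 < c < t], and
    [cosh(c)^2 = 1 + sinh(c)^2 > 1]. *)
Lemma tanh_lt_id (t : R) : 0 < t -> tanh t < t.
Proof.
  intros Ht.
  destruct (MVT_cor2 tanh (fun c => / (cosh c * cosh c)) 0 t Ht)
    as [c [Heq [Hc _]]].
  { intros c _; apply derivable_pt_lim_tanh. }
  assert (/ (cosh c * cosh c) < 1).
  { pose proof (sinh_lt 0 c Hc) as Hs; rewrite sinh_0 in Hs.
    pose proof (cosh_sqr_minus_sinh_sqr c).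
    rewrite <- Rinv_1; apply Rinv_lt_contravar; nra. }
  rewrite tanh_0 in Heq; nra.
Qed.

Lemma tanh_le_id (t : R) : 0 <= t -> tanh t <= t.
Proof.
  intros [Ht | <-]; [left; now apply tanh_lt_id | rewrite tanh_0; lra].
Qed.

(** Holds because [tanh] is odd and increasing, hence has the sign of its argument. *)
Lemma Rabs_tanh (x : R) : Rabs (tanh x) = tanh (Rabs x).
Proof.
  destruct (Rle_or_lt 0 x) as [Hx | Hx].
  - rewrite (Rabs_pos_eq x Hx); apply Rabs_pos_eq.
    rewrite <- tanh_0; now apply tanh_le.
  - rewrite (Rabs_left x Hx), tanh_opp; apply Rabs_left.
    rewrite <- tanh_0; now apply tanh_lt.
Qed.

(** Since [|a x| <= |x|], monotonicity gives a bound free of [a]: the varying maps are all compared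
    with the single map [tanh]. *)
Lemma Rabs_phi_le (a x : R) : 0 < a <= 1 -> Rabs (phi a x) <= tanh (Rabs x).
Proof.
  intros Ha; unfold phi; rewrite Rabs_tanh; apply tanh_le.
  rewrite Rabs_mult, (Rabs_pos_eq a) by lra.
  pose proof (Rabs_pos x); nra.
Qed.

Lemma Un_cv_0_of_le_tanh (u : nat -> R) :
  (forall n, 0 <= u n) -> (forall n, u (S n) <= tanh (u n)) -> Un_cv u 0.
Proof.
  intros Hpos Hstep.
  assert (Hdec : Un_decreasing u).
  { intros n; apply Rle_trans with (tanh (u n)); [apply Hstep|].
    apply tanh_le_id, Hpos. }
  destruct (decreasing_cv u Hdec) as [l Hl].
  (* [decreasing_cv] asks for an upper bound of the negated sequence; [0] is one since [u] is
     nonnegative. *)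
  { exists 0; intros y [n ->]; unfold opp_seq.
    pose proof (Hpos n); lra. }
  assert (Hl0 : 0 <= l).
  { apply (@Rle_cv_lim (fun _ => 0) u); [exact Hpos | | exact Hl].
    intros eps Heps; exists 0%nat; intros n _; now rewrite Rdist_eq. }
  assert (Hlt : l <= tanh l).
  { apply (@Rle_cv_lim (fun n => u (n + 1)%nat) (fun n => tanh (u n))).
    - intros n; rewrite Nat.add_1_r; apply Hstep.
    - now apply CV_shift'.
    - apply continuity_seq; [apply continuity_pt_tanh | exact Hl]. }
  destruct Hl0 as [Hl0 | <-]; [|exact Hl].
  pose proof (tanh_lt_id l Hl0); lra.
Qed.

Theorem proposition3 (a : nat -> R)
  (ha : forall n : nat, (1 <= n)%nat -> 0 < a n)
  (hfin : Finite nat (fun n : nat => (1 <= n)%nat /\ 1 < a n)) :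
  forall x : R, Un_cv (fun m : nat => Phi a m x) 0.
Proof.
  intros x.
  (* [N] bounds every index with [1 < a n], so strictly beyond [N] the parameters lie in
     [(0, 1]]. *)
  destruct (Finite_subset_has_lub _ hfin) as [N [_ HN]].
  assert (Hle : forall n, (N < n)%nat -> 0 < a n <= 1).
  { intros n Hn; split; [apply ha; lia|].
    apply Rnot_lt_le; intros Hlt.
    enough (n <= N)%nat by lia.
    apply HN; split; [lia | exact Hlt]. }
  apply (CV_shift _ N).
  assert (Hcv : Un_cv (fun m => Rabs (Phi a (m + N) x)) 0).
  { apply Un_cv_0_of_le_tanh.
    - intros m; apply Rabs_pos.
    (* Passing from [m + N] to its successor applies [phi] with parameter [a (S (m + N))], whose
       index exceeds [N] even at [m = 0]. *)
    - intros m; apply (Rabs_phi_le (a (S (m + N)))), Hle; lia. }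
  (* A real number and its absolute value are equally far from [0], so the same threshold [M]
     works. *)
  intros eps Heps; destruct (Hcv eps Heps) as [M HM].
  exists M; intros m Hm; specialize (HM m Hm).
  unfold Rdist in *; rewrite Rminus_0_r in *.
  now rewrite Rabs_Rabsolu in HM.
Qed.
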